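(* Let $M$ be a 1-motive defined over $K\subseteq\mathbb{C}$ and $M^*$ its Cartier dual. With the matrices of periods $\Pi_A$, $\Pi_{A^*}$, $\Upsilon_Q$, $\Upsilon_P$, $\widetilde{\log}_A(P)$, $\widetilde{\log}_{A^*}(Q)$, $\Xi_R$, $\Xi_{R^*}$ defined in the context, one has \begin{itemize} \item $\Upsilon_Q=-\Pi_A\big(\widetilde{\log}_{A^*}(Q)\big)^t$, \item $\Upsilon_P=-\Pi_{A^*}\big(\widetilde{\log}_A(P)\big)^t$, \item $\Xi_R^t+\Xi_{R^*}=-\widetilde{\log}_{A^*}(Q)\big(\widetilde{\log}_A(P)\big)^t$. \end{itemize}
   Context: Data. $M=[u:X\to G]$ is a 1-motive over $K\subseteq\mathbb{C}$: $X$ a Galois module free of rank $n$ over $\mathbb{Z}$, $\pi:G\to A$ an extension of a $g$-dimensional abelian variety $A$ by an $s$-dimensional torus $Y(1)$ with character group $Y^\vee$. Bases of $X$ and $Y^\vee$ determine points $P_1,\dots,P_n\in A$, $Q_1,\dots,Q_s\in A^*$ (the dual of $A$, the $Q_k$ parametrizing $G$), and $R_i=u(x_i)\in G$ above $P_i$. The Cartier dual is $M^*=[u^*:Y^\vee\to G^*]$, with $G^*$ the extension of $A^*$ by the torus with character group $X$ parametrized by $P_1,\dots,P_n$, and $R_k^*=u^*(y_k^\vee)\in G^*$ above $Q_k$; $u$ and $u^*$ correspond to the same biadditive trivialization $\psi$ of the pull-back of the Poincaré biextension to $X\times Y^\vee$. Theta functions. Up to isogeny $A$ has a principal polarization $H$.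 Write $A(\mathbb{C})=\mathbb{C}^g/\Lambda$. Identify the dual $A^*(\mathbb{C})=\mathrm{Hom}_{\overline{\mathbb{C}}}(\mathbb{C}^g,\mathbb{C})/\Lambda^*$ (antilinear forms; $\Lambda^*=\{\lambda^*:\mathrm{Im}\,\lambda^*(\Lambda)\subset\mathbb{Z}\}$) with $\mathbb{C}^g/\phi_H^{-1}(\Lambda^* )$ via $\phi_H(z)=H(z,\cdot)$. Let $\theta$ be a theta function with first Chern class $H$ (functional equation $\theta(z+\lambda)=\chi(\lambda)e^{\pi H(z,\lambda)+\frac{\pi}{2}H(\lambda,\lambda)}\theta(z)$, $\chi$ a semi-character), with $\theta(0)=1$ and $d\log\theta(0)=0$. Put $d\log\theta=\sum_j h_j\,dz_j$ and $F_q(z)=\frac{\theta(z+q)}{\theta(z)\theta(q)}e^{-\sum_j h_j(q)z_j}$. Let $\omega_j=dz_j$, and let $\eta_j$ be the differential of the second kind with $\exp_A^*\eta_j=dh_j$. Fix logarithms $p_i\in\mathbb{C}^g$ of $P_i$ and $q_k\in\mathbb{C}^g$ with $\phi_H(q_k)$ a logarithm of $Q_k$; the theta values occurring are assumed nonzero. Differentials of the third kind. $\xi_{Q_k}$ is the form on $A$ whose pull-back to $\mathbb{C}^g$ is $d\log F_{q_k}$. $\tilde\xi_{Q_k}$ is the pull-back of $dZ_k/Z_k$ by the rational map $G\cong A\times\mathbb{G}_m^s\to\mathbb{G}_m$ (projection to the $k$-th factor), where the exponential of the push-out $G_{Q_k}$ is $(z,t)\mapsto(\exp_A(z),e^tF_{q_k}(z))$.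 $\xi^G_{Q_k}=-\tilde\xi_{Q_k}+\pi^*\xi_{Q_k}$ is an invariant differential on $G$. The form $\xi^{G^*}_{P_i}$ on $G^*$ is defined analogously, from $F_{p_i}$ evaluated in the variable $q\in\mathbb{C}^g$ on $A^*$. Cycles. $\lambda_1,\dots,\lambda_{2g}$ is a basis of $\Lambda$, symplectic for $\mathrm{Im}\,H$ (matrix $J=\begin{pmatrix}0&\mathrm{Id}_g\\-\mathrm{Id}_g&0\end{pmatrix}$). $\gamma_1,\dots,\gamma_{2g}$ are loops lifting $\lambda_1,\dots,\lambda_{2g}$ in $G$, chosen (modulo $H_1(\mathbb{G}_m^s,\mathbb{Z})$) so that $\int_{\gamma_i}\tilde\xi_{Q_k}=0$; the same convention is used for $G^*$. Paths $[O,R_i]$ in $G$ and $[O,R_k^*]$ in $G^*$ lift to paths from $0$ to logarithms of $R_i=(P_i,e^{\ell_{i,1}},\dots,e^{\ell_{i,s}})$ and $R_k^*=(Q_k,e^{\ell_{1,k}},\dots,e^{\ell_{n,k}})$ with the same $\ell_{i,k}$, so that $\int_O^{R_i}\tilde\xi_{Q_k}=\int_O^{R_k^*}\tilde\xi_{P_i}=\ell_{i,k}$. Matrices. $\Omega_1=(\int_z^{\lambda_i+z}\omega_j)_{i,j\le g}$, $\Omega_2=(\int_z^{\lambda_{g+i}+z}\omega_j)_{i,j\le g}$, $N_1=(\int_z^{\lambda_i+z}\eta_j)_{i,j\le g}$, $N_2=(\int_z^{\lambda_{g+i}+z}\eta_j)_{i,j\le g}$ and $$\Pi_A=\begin{pmatrix}\Omega_1&N_1\\\Omega_2&N_2\end{pmatrix},\qquad\Pi_{A^*}=\begin{pmatrix}N_2&-\Omega_2\\-N_1&\Omega_1\end{pmatrix}.$$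 Further, $\widetilde{\log}_A(P)=\big(\int_z^{p_i+z}\omega_j,\ \int_z^{p_i+z}\eta_j\big)_{i\le n,\,j\le g}$ (size $n\times2g$), $\widetilde{\log}_{A^*}(Q)=\big(\int_z^{q_k+z}\eta_j,\ -\int_z^{q_k+z}\omega_j\big)_{k\le s,\,j\le g}$ (size $s\times2g$), $\Upsilon_Q=(\int_{\gamma_i}\xi^G_{Q_k})_{i\le2g,\,k\le s}$, $\Upsilon_P=\begin{pmatrix}-\int_{\gamma_{g+j}}\xi^{G^*}_{P_i}\\ \int_{\gamma_j}\xi^{G^*}_{P_i}\end{pmatrix}_{j\le g,\,i\le n}$ (size $2g\times n$), $\Xi_R=(\int_O^{R_i}\xi^G_{Q_k})_{i\le n,\,k\le s}$, $\Xi_{R^*}=(-\int_O^{R_k^*}\xi^{G^*}_{P_i})_{k\le s,\,i\le n}$. Conventions for integrals along open paths. They are understood in the sense of generalized logarithms, i.e. after modifying the forms in their classes by exact forms so that $\int_z^{p+z}\eta_j=h_j(p)$, $\int_O^{R_i}\xi^G_{Q_k}=\log F_{q_k}(p_i)-\ell_{i,k}$ and $\int_O^{R_k^*}\xi^{G^*}_{P_i}=\log F_{p_i}(q_k)-\ell_{i,k}$. Logarithms are taken with compatible branches, i.e. so that $\log\frac{F_{q_k}(\lambda_i+z)}{F_{q_k}(z)}=\pi H(q_k,\lambda_i)-\sum_jh_j(q_k)\int_z^{\lambda_i+z}\omega_j$ (and likewise for $F_{p_i}$), and $\log F_{q_k}(p_i)-\log F_{p_i}(q_k)=\sum_j\big(h_j(p_i)(q_k)_j-h_j(q_k)(p_i)_j\big)$.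 *)

(* Defs.v *)
From HB Require Import structures.
From mathcomp Require Import all_boot all_order all_algebra.
From mathcomp Require Import all_classical all_reals all_analysis.
From mathcomp Require Import complex.

Set Implicit Arguments.
Unset Strict Implicit.
Unset Printing Implicit Defensive.

Import Order.TTheory GRing.Theory Num.Theory numFieldNormedType.Exports.

Local Open Scope classical_set_scope.
Local Open Scope ring_scope.
Local Open Scope complex_scope.

(* C^m is 'rV[R[i]]_m; scalar functions take values in R[i]^o, the line
   R[i] seen as a normed module over itself, so that derive and differentiable
   are the complex directional derivative and complex differentiability. *)

Section ComplexAnalysis.
Context {R : realType}.
Local Notation C := R[i].

Definition cexp (z : C) : C :=
  (expR (complex.Re z) * cos (complex.Im z)) +i*
  (expR (complex.Re z) * sin (complex.Im z)).

Definition partial m (j : 'I_m) (f : 'rV[C]_m -> C^o) : 'rV[C]_m -> C^o :=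
  fun z => 'D_(delta_mx 0 j) f z.

(* Complex differentiability is required to all orders: for functions on C^m
   this follows from order one, by Cauchy's formula. *)
Fixpoint differentiable_upto m (n : nat) (f : 'rV[C]_m -> C^o) : Prop :=
  if n is n'.+1 then
    (forall z, differentiable f z) /\
    (forall j, differentiable_upto n' (partial j f))
  else True.

Definition entire m (f : 'rV[C]_m -> C^o) : Prop :=
  forall n, differentiable_upto n f.

(* A 1-form of type (1,0) on C^m is given by its coefficients in the basis
   dz_1, ..., dz_m. *)
Definition form m := 'rV[C]_m -> 'rV[C]_m.

Definition exact m (f : 'rV[C]_m -> C^o) : form m :=
  fun z => \row_j partial j f z.

Definition dlog m (f : 'rV[C]_m -> C^o) : form m :=
  fun z => \row_j (partial j f z / f z).

(* Paths are parametrized by [0, 1]; they are taken defined and C^1 on the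
   whole line, which is no restriction. *)
Definition re_coord m (c : R -> 'rV[C]_m) (j : 'I_m) : R -> R :=
  fun t => complex.Re (c t 0 j).
Definition im_coord m (c : R -> 'rV[C]_m) (j : 'I_m) : R -> R :=
  fun t => complex.Im (c t 0 j).

Definition C1_path m (c : R -> 'rV[C]_m) : Prop :=
  forall j,
    [/\ forall t, derivable (re_coord c j) t 1,
        forall t, derivable (im_coord c j) t 1,
        continuous (re_coord c j)^`()%classic
      & continuous (im_coord c j)^`()%classic].

Definition velocity m (c : R -> 'rV[C]_m) (t : R) : 'rV[C]_m :=
  \row_j (((re_coord c j)^`()%classic t) +i* ((im_coord c j)^`()%classic t)).

Definition along m (c : R -> 'rV[C]_m) (P : 'rV[C]_m -> Prop) : Prop :=
  forall t, 0 <= t <= 1 -> P (c t).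

Definition pullback m (w : form m) (c : R -> 'rV[C]_m) (t : R) : C :=
  \sum_j w (c t) 0 j * velocity c t 0 j.

Definition path_integral m (w : form m) (c : R -> 'rV[C]_m) : C :=
  (\int[lebesgue_measure]_(t in `[0, 1]) complex.Re (pullback w c t)) +i*
  (\int[lebesgue_measure]_(t in `[0, 1]) complex.Im (pullback w c t)).

(* f is a meromorphic function on C^m / L (a quotient of two entire functions
   on C^m, periodic under L), with no pole on the path c. *)
Definition meromorphic_mod m (L : set 'rV[C]_m) (f : 'rV[C]_m -> C^o)
    (c : R -> 'rV[C]_m) : Prop :=
  exists a b : 'rV[C]_m -> C^o,
    [/\ entire a, entire b, along c (fun z => b z != 0),
        forall z, b z != 0 -> f z = a z / b z
      & forall z l, L l -> b z != 0 -> b (z + l) != 0 -> f (z + l) = f z].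

End ComplexAnalysis.

Section AbelianVariety.
Context {R : realType}.
Local Notation C := R[i].

(* Linear in z and antilinear in w. *)
Definition sesqui g (Hm : 'M[C]_g) (z w : 'rV[C]_g) : C :=
  (z *m Hm *m (map_mx conjc w)^T) 0 0.

Definition standard_symplectic g : 'M[R]_(g + g) :=
  block_mx 0 1%:M (- 1%:M) 0.

(* C^g / Lambda with a principal polarization: the existence of a basis of
   Lambda in which Im H has the matrix J says that H is principal. *)
Record ppav g := Ppav {
  hermitian_mx : 'M[C]_g;
  lambda : 'I_(g + g) -> 'rV[C]_g;
  hermitian_sym :
    forall z w, sesqui hermitian_mx w z = conjc (sesqui hermitian_mx z w);
  hermitian_pos : forall z, z != 0 -> 0 < sesqui hermitian_mx z z;
  lambda_basis :
    forall z, exists! a : 'rV[R]_(g + g), z = \sum_i (a 0 i)%:C *: lambda i;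
  lambda_symplectic :
    forall i j, complex.Im (sesqui hermitian_mx (lambda i) (lambda j)) =
                standard_symplectic g i j
}.

Definition H g (A : ppav g) : 'rV[C]_g -> 'rV[C]_g -> C :=
  sesqui (hermitian_mx A).

Definition lattice g (A : ppav g) : set 'rV[C]_g :=
  [set z | exists a : 'rV[int]_(g + g),
     z = \sum_i (a 0 i)%:~R *: lambda A i].

Definition antilinear g (l : 'rV[C]_g -> C) : Prop :=
  forall (a : C) z w, l (a *: z + w) = conjc a * l z + l w.

Definition dual_lattice g (A : ppav g) : set ('rV[C]_g -> C) :=
  [set l | antilinear l /\
     forall z, lattice A z -> exists m : int, complex.Im (l z) = m%:~R].

(* A^* is C^g / lattice_dual A: a vector w of C^g stands for the antilinear
   form phi_H w = H (w, -). *)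
Definition lattice_dual g (A : ppav g) : set 'rV[C]_g :=
  [set w | dual_lattice A (H A w)].

Definition semicharacter g (A : ppav g) (chi : 'rV[C]_g -> C) : Prop :=
  (forall l, lattice A l -> `|chi l| = 1) /\
  (forall l m, lattice A l -> lattice A m ->
     chi (l + m) =
     chi l * chi m * cexp ('i * (pi * complex.Im (H A l m))%:C)).

Definition normalized_theta g (A : ppav g) (theta : 'rV[C]_g -> C^o) : Prop :=
  [/\ entire theta,
      exists2 chi, semicharacter A chi &
        forall z l, lattice A l ->
          theta (z + l) =
          chi l * cexp (pi%:C * H A z l + pi%:C / 2 * H A l l) * theta z,
      theta 0 = 1
    & dlog theta 0 = 0].

Section Theta.
Variables (g : nat) (theta : 'rV[C]_g -> C^o).

Definition h (j : 'I_g) : 'rV[C]_g -> C^o := fun z => dlog theta z 0 j.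

Definition F (q : 'rV[C]_g) : 'rV[C]_g -> C^o :=
  fun z => theta (z + q) / (theta z * theta q) *
           cexp (- \sum_j h j q * z 0 j).

(* Differentials of the first, second and third kind, pulled back to C^g. *)
Definition omega (j : 'I_g) : @form R g := fun=> delta_mx 0 j.
Definition eta (j : 'I_g) : form g := exact (h j).
Definition xi (q : 'rV[C]_g) : form g := dlog (F q).

(* Extensions.  G is the extension of C^g / L by G_m^s parametrized by
   q_1, ..., q_s.  Its universal cover is C^g x C^s = 'rV_(g + s), and
   G_coord q k (z, t) = e^(t_k) F_(q_k)(z) is the k-th torus coordinate of
   exp_G (z, t) under the rational isomorphism of G with A x G_m^s. *)
Section Extension.
Variables (L : set 'rV[C]_g) (s : nat) (q : 'I_s -> 'rV[C]_g).

Definition G_coord (k : 'I_s) : 'rV[C]_(g + s) -> C^o :=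
  fun x => cexp (rsubmx x 0 k) * F (q k) (lsubmx x).

(* The domain where every G_coord q k is regular and nonzero. *)
Definition G_regular (x : 'rV[C]_(g + s)) : Prop :=
  theta (lsubmx x) != 0 /\ forall k, theta (lsubmx x + q k) != 0.

(* Translations of the universal cover that do not change the image under
   exp_G, that is H_1(G, Z). *)
Definition G_kernel : set 'rV[C]_(g + s) :=
  [set l | L (lsubmx l) /\
     forall x k, G_regular x -> G_regular (x + l) ->
       G_coord k (x + l) = G_coord k x].

Definition pull_pi (w : @form R g) : @form R (g + s) :=
  fun x => row_mx (w (lsubmx x)) 0.

Definition xi_tilde (k : 'I_s) : form (g + s) := dlog (G_coord k).

Definition xi_G (k : 'I_s) : form (g + s) :=
  fun x => - xi_tilde k x + pull_pi (xi (q k)) x.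

(* A homomorphism u : Z^n -> G(C) = C^(g + s) / G_kernel, given by
   representatives in the universal cover. *)
Record one_motive (n : nat) := OneMotive {
  u : 'rV[int]_n -> 'rV[C]_(g + s);
  u_add : forall x y, G_kernel (u (x + y) - (u x + u y))
}.

(* A C^1 loop in G, lifted to the universal cover, above the class l. *)
Definition loop_above (l : 'rV[C]_g) (c : R -> 'rV[C]_(g + s)) : Prop :=
  [/\ C1_path c, along c G_regular, G_kernel (c 1 - c 0)
    & lsubmx (c 1) = lsubmx (c 0) + l].

(* A C^1 path in G from O to exp_G x, lifted to the universal cover and
   ending above the chosen logarithm p of pi (exp_G x). *)
Definition path_to (x : 'rV[C]_(g + s)) (p : 'rV[C]_g)
    (c : R -> 'rV[C]_(g + s)) : Prop :=
  [/\ C1_path c, along c G_regular, c 0 = 0, G_kernel (c 1 - x)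
    & lsubmx (c 1) = p].

End Extension.

(* A C^1 path in C^g from z to z + v, z arbitrary, avoiding the poles of the
   eta_j. *)
Definition path_by (v : 'rV[C]_g) (c : R -> 'rV[C]_g) : Prop :=
  [/\ C1_path c, along c (fun z => theta z != 0) & c 1 = c 0 + v].

Definition basis_vec n (i : 'I_n) : 'rV[int]_n := delta_mx 0 i.

(* M = [u : Z^n -> G] and M' = [u^* : Z^s -> G^*] are Cartier dual, with
   p_i over pi (u x_i) and q_k over pi (u^* y_k): G is parametrized by q and
   G^* by p, and the values psi (x_i, y_k) read on the torus coordinates of
   u x_i and of u^* y_k coincide. *)
Definition cartier_dual (A : ppav g) n s
    (p : 'I_n -> 'rV[C]_g) (q : 'I_s -> 'rV[C]_g)
    (M : one_motive (lattice A) q n)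
    (M' : one_motive (lattice_dual A) p s) : Prop :=
  [/\ forall i, lattice A (lsubmx (u M (basis_vec i)) - p i),
      forall k, lattice_dual A (lsubmx (u M' (basis_vec k)) - q k)
    & forall i k, G_coord q k (u M (basis_vec i)) =
                  G_coord p i (u M' (basis_vec k))].

End Theta.

Section PeriodMatrices.
Variables (g : nat) (theta : 'rV[C]_g -> C^o).

(* alpha i is a path from z to z + lambda_i. *)
Section Periods.
Variable alpha : 'I_(g + g) -> R -> 'rV[C]_g.

Definition Omega1 : 'M[C]_g :=
  \matrix_(i, j) path_integral (omega j) (alpha (lshift g i)).
Definition Omega2 : 'M[C]_g :=
  \matrix_(i, j) path_integral (omega j) (alpha (rshift g i)).
Definition N1 : 'M[C]_g :=
  \matrix_(i, j) path_integral (eta theta j) (alpha (lshift g i)).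
Definition N2 : 'M[C]_g :=
  \matrix_(i, j) path_integral (eta theta j) (alpha (rshift g i)).

Definition Pi_A : 'M[C]_(g + g) := block_mx Omega1 N1 Omega2 N2.
Definition Pi_Adual : 'M[C]_(g + g) := block_mx N2 (- Omega2) (- N1) Omega1.

End Periods.

(* Along open paths, the form eta_j (resp. xi^G) is modified by the exact form
   d(f i j) (resp. d(phi i k)), which may depend on the path. *)
Definition eta_mod (f : 'rV[C]_g -> C^o) (j : 'I_g) : form g :=
  fun z => eta theta j z + exact f z.

Definition log_A n (a : 'I_n -> R -> 'rV[C]_g)
    (f : 'I_n -> 'I_g -> 'rV[C]_g -> C^o) : 'M[C]_(n, g + g) :=
  row_mx (\matrix_(i, j) path_integral (omega j) (a i))
         (\matrix_(i, j) path_integral (eta_mod (f i j) j) (a i)).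

Definition log_Adual s (b : 'I_s -> R -> 'rV[C]_g)
    (f : 'I_s -> 'I_g -> 'rV[C]_g -> C^o) : 'M[C]_(s, g + g) :=
  row_mx (\matrix_(k, j) path_integral (eta_mod (f k j) j) (b k))
         (\matrix_(k, j) - path_integral (omega j) (b k)).

Definition xi_G_mod s (q : 'I_s -> 'rV[C]_g)
    (phi : 'rV[C]_(g + s) -> C^o) (k : 'I_s) : form (g + s) :=
  fun x => xi_G theta q k x + exact phi x.

Definition Upsilon_Q s (q : 'I_s -> 'rV[C]_g)
    (gamma : 'I_(g + g) -> R -> 'rV[C]_(g + s)) : 'M[C]_(g + g, s) :=
  \matrix_(i, k) path_integral (xi_G theta q k) (gamma i).

Definition Upsilon_P n (p : 'I_n -> 'rV[C]_g)
    (gamma : 'I_(g + g) -> R -> 'rV[C]_(g + n)) : 'M[C]_(g + g, n) :=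
  col_mx
    (\matrix_(j, i) - path_integral (xi_G theta p i) (gamma (rshift g j)))
    (\matrix_(j, i) path_integral (xi_G theta p i) (gamma (lshift g j))).

Definition Xi_R n s (q : 'I_s -> 'rV[C]_g)
    (r : 'I_n -> R -> 'rV[C]_(g + s))
    (phi : 'I_n -> 'I_s -> 'rV[C]_(g + s) -> C^o) : 'M[C]_(n, s) :=
  \matrix_(i, k) path_integral (xi_G_mod q (phi i k) k) (r i).

Definition Xi_Rdual n s (p : 'I_n -> 'rV[C]_g)
    (r : 'I_s -> R -> 'rV[C]_(g + n))
    (phi : 'I_s -> 'I_n -> 'rV[C]_(g + n) -> C^o) : 'M[C]_(s, n) :=
  \matrix_(k, i) - path_integral (xi_G_mod p (phi k i) i) (r k).

(* gamma_i is normalized by int_(gamma_i) xi_tilde = 0, and the branch of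
   log (F_(q_k)(z + lambda_i) / F_(q_k)(z)), which is the integral of
   pi^* xi_(q_k) along gamma_i, is the one given by the functional equation. *)
Definition normalized_loops (A : ppav g) (L : set 'rV[C]_g) s
    (q : 'I_s -> 'rV[C]_g) (alpha : 'I_(g + g) -> R -> 'rV[C]_g)
    (gamma : 'I_(g + g) -> R -> 'rV[C]_(g + s)) : Prop :=
  [/\ forall i, loop_above theta L q (lambda A i) (gamma i),
      forall i k, path_integral (xi_tilde theta q k) (gamma i) = 0
    & forall i k,
        path_integral (pull_pi (xi theta (q k))) (gamma i) =
        pi%:C * H A (q k) (lambda A i)
        - \sum_j h theta j (q k) * path_integral (omega j) (alpha i)].

(* a_i is a path from z to z + p_i, and the eta_j are modified by exact forms
   so that their integrals are the h_j (p_i). *)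
Definition generalized_log (L : set 'rV[C]_g) n (p : 'I_n -> 'rV[C]_g)
    (a : 'I_n -> R -> 'rV[C]_g) (f : 'I_n -> 'I_g -> 'rV[C]_g -> C^o) : Prop :=
  [/\ forall i, path_by theta (p i) (a i),
      forall i j, meromorphic_mod L (f i j) (a i)
    & forall i j, path_integral (eta_mod (f i j) j) (a i) = h theta j (p i)].

(* r_i is a path from O to exp_G (R i) on which the integral of xi_tilde is
   l i k, and the xi^G are modified by exact forms so that their integrals are
   logF i k - l i k. *)
Definition generalized_log_G (L : set 'rV[C]_g) n s (p : 'I_n -> 'rV[C]_g)
    (q : 'I_s -> 'rV[C]_g) (Rpt : 'I_n -> 'rV[C]_(g + s))
    (l logF : 'I_n -> 'I_s -> C) (r : 'I_n -> R -> 'rV[C]_(g + s))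
    (phi : 'I_n -> 'I_s -> 'rV[C]_(g + s) -> C^o) : Prop :=
  [/\ forall i, path_to theta L q (Rpt i) (p i) (r i),
      forall i k, path_integral (xi_tilde theta q k) (r i) = l i k,
      forall i k, meromorphic_mod (G_kernel theta L q) (phi i k) (r i)
    & forall i k,
        path_integral (xi_G_mod q (phi i k) k) (r i) = logF i k - l i k].

End PeriodMatrices.

End AbelianVariety.

(* Main.v *)
Require Import Defs.
From HB Require Import structures.
From mathcomp Require Import all_boot all_order all_algebra.
From mathcomp Require Import all_classical all_reals all_analysis.
From mathcomp Require Import complex ring lra.

Set Implicit Arguments.
Unset Strict Implicit.
Unset Printing Implicit Defensive.

Import Order.TTheory GRing.Theory Num.Theory numFieldNormedType.Exports.

Local Open Scope classical_set_scope.
Local Open Scope ring_scope.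
Local Open Scope complex_scope.

(* The eta_j are exact on C^g minus the zeros of theta, with primitive h_j, so
   their integral along a path from z to z + lambda_i is h_j(z + lambda_i) -
   h_j(z), which by the logarithmic derivative of the functional equation of
   theta is pi H(e_j, lambda_i).  By linearity of H in its first argument,
   pi H(q_k, lambda_i) is then the sum over j of the j-th coordinate of q_k times
   the i-th period of eta_j.  On the other hand the normalization of gamma_i
   makes the integral of xi^G along gamma_i equal to that of pi^* xi, namely
   pi H(q_k, lambda_i) - sum_j h_j(q_k) int_(lambda_i) omega_j.  This gives the
   entries of both Upsilon_Q and Upsilon_P.  In the last identity the l_(i,k)
   cancel, and what remains is the compatibility of log F_(q_k)(p_i) with
   log F_(p_i)(q_k). *)

(** * Limits in C and C^m, read on real and imaginary parts and on coordinates *)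

Section ComplexLimits.
Context {R : realType}.
Local Notation C := R[i].
Context {T : Type} {G : set_system T} {FG : Filter G}.

Lemma cvg_Re (f : T -> C^o) (z : C) :
  f x @[x --> G] --> (z : C^o) ->
  complex.Re (f x) @[x --> G] --> complex.Re z.
Proof.
move=> /cvgrPdist_lt fz; apply/cvgrPdist_lt => e e0.
have e0' : 0 < e%:C by rewrite ltcR.
apply: filterS (fz _ e0') => x /=.
rewrite -ltcR; apply: le_lt_trans; rewrite -raddfB; exact: normc_ge_Re.
Qed.

Lemma cvg_Im (f : T -> C^o) (z : C) :
  f x @[x --> G] --> (z : C^o) ->
  complex.Im (f x) @[x --> G] --> complex.Im z.
Proof.
move=> /cvgrPdist_lt fz; apply/cvgrPdist_lt => e e0.
have e0' : 0 < e%:C by rewrite ltcR.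
apply: filterS (fz _ e0') => x /=.
(* Since -Im z = Re (i z) and |i| = 1, the bound of the real part by the modulus, applied to i z,
   also bounds the imaginary part. *)
rewrite -ltcR; apply: le_lt_trans; rewrite -raddfB -normrN -ReiNIm.
apply: le_trans (normc_ge_Re _) _.
by rewrite normrM complexiE normCi mulr1.
Qed.

Lemma normc_le_ReIm (z : C) :
  `|z| <= (`|complex.Re z| + `|complex.Im z|)%:C.
Proof.
rewrite {1}[z]complexE; apply: le_trans (ler_normD _ _) _.
rewrite rmorphD normrM complexiE normCi mul1r /= !normc_def /=.
by rewrite !expr0n /= !addr0 !sqrtr_sqr.
Qed.

Lemma cvg_complex (f : T -> C^o) (z : C) :
  complex.Re (f x) @[x --> G] --> complex.Re z ->
  complex.Im (f x) @[x --> G] --> complex.Im z ->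
  f x @[x --> G] --> (z : C^o).
Proof.
move=> /cvgrPdist_lt fr /cvgrPdist_lt fi; apply/cvgrPdist_lt => e e0.
(* A positive element of C is real in the order used here, so half of its real part can be allotted
   to each of the two errors. *)
have [er ei] : 0 < complex.Re e /\ complex.Im e = 0.
  by move: e0; rewrite ltcE /= => /andP[/eqP-> ].
have e2 : 0 < complex.Re e / 2 by rewrite divr_gt0.
apply: filterS2 (fr _ e2) (fi _ e2) => x /= h1 h2.
apply: le_lt_trans (normc_le_ReIm _) _.
rewrite ltcE /= ei eqxx /= [ltRHS]splitr.
by rewrite ltrD// raddfB.
Qed.

End ComplexLimits.

Lemma cvg_rV {T : Type} {G : set_system T} {FG : Filter G} (K : numFieldType) m
    (f : T -> 'rV[K]_m) (z : 'rV[K]_m) :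
  (forall j, f x 0 j @[x --> G] --> z 0 j) -> f x @[x --> G] --> z.
Proof.
move=> fz; apply/cvg_ballP => e e0.
have : \forall x \near G, forall j, ball (z 0 j) e (f x 0 j).
  by apply: filter_forall => j; move/cvg_ballP : (fz j) => /(_ _ e0).
apply: filterS => x H; split => // i j.
by rewrite !ord1; exact: H.
Qed.

Lemma cvg_sumr (K : numFieldType) (V : normedModType K) {T : Type}
    {G : set_system T} {FG : Filter G} m (f : 'I_m -> T -> V) (l : 'I_m -> V) :
  (forall j, f j x @[x --> G] --> l j) ->
  \sum_j f j x @[x --> G] --> \sum_j l j.
Proof.
move=> fl; apply: (@cvg_big V _ +%R 0 xpredT) => //.
exact: add_continuous.
Qed.

(** * Differentials in coordinates and a chain rule along filters *)

Lemma differential_sum (K : numFieldType) m (f : 'rV[K]_m -> K^o) (x v : 'rV[K]_m) :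
  differentiable f x ->
  'd f x v = \sum_j 'D_(delta_mx 0 j) f x * v 0 j.
Proof.
move=> df; rewrite {1}[v]row_sum_delta linear_sum; apply: eq_bigr => j _.
by rewrite linearZ /= deriveE// mulrC.
Qed.

(* The difference quotients of f o c are the values of the differential of f on
   those of c, up to the remainder of f. *)
Lemma cvg_chain (T : Type) (G : set_system T) (FG : Filter G) (K : numFieldType) m
    (f : 'rV[K]_m -> K^o) (x v : 'rV[K]_m) (a : T -> K) (w : T -> 'rV[K]_m) :
  differentiable f x -> (\forall s \near G, a s != 0) ->
  (w s @[s --> G] --> x) ->
  ((a s)^-1 *: (w s - x) @[s --> G] --> v) ->
  ((a s)^-1 * (f (w s) - f x) @[s --> G] -->
    (\sum_j 'D_(delta_mx 0 j) f x * v 0 j : K^o)).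
Proof.
move=> df a0 wx wv; rewrite -differential_sum//.
have [dc /eqaddoP] := (diff_locallyP _ _).1 df => ro.
have w0 : w s - x @[s --> G] --> (0 : 'rV[K]_m).
  by rewrite -(subrr x); apply: cvgB => //; exact: cvg_cst.
rewrite -[X in _ --> X]add0r.
have -> : (fun s => (a s)^-1 * (f (w s) - f x)) =
  (fun s => ((a s)^-1 * (f (w s) - f x - 'd f x (w s - x)) +
     'd f x ((a s)^-1 *: (w s - x)) : K^o)).
  apply/funext => s; rewrite linearZ /= -[_ *: _]/(_ * _) -mulrDr.
  by rewrite subrK.
apply: cvgD; last by have := cvg_comp _ _ wv (dc v); exact.
apply/cvgrPdist_le => e e0.
(* Eventually |w s - x| <= |a s| (|v| + 1), because the quotients tend to [v]; a remainder of at
   most e / (|v| + 1) times |w s - x| then stays below [e] after division by [a s]. *)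
have v1 : 0 < `|v| + 1 by rewrite ltr_wpDl.
have ev : 0 < e / (`|v| + 1) by rewrite divr_gt0.
have H : \forall s \near G,
    `|f (w s) - f x - 'd f x (w s - x)| <= e / (`|v| + 1) * `|w s - x|.
  have hh : G (fun s => `|(f \o shift x - (cst (f x) + 'd f x)) (w s - x)|
      <= e / (`|v| + 1) * `|w s - x|) := w0 _ (ro _ ev).
  by apply: filterS hh => s; rewrite !fctE /= subrK opprD addrA.
have H2 := (cvgr_dist_le _ _ wv) _ ltr01.
near=> s.
have as0 : a s != 0 by near: s.
rewrite sub0r normrN normrM normfV ler_pdivrMl ?normr_gt0//.
have : `|f (w s) - f x - 'd f x (w s - x)| <= e / (`|v| + 1) * `|w s - x|.
  by near: s.
move=> /le_trans; apply.
have : `|v - (a s)^-1 *: (w s - x)| <= 1.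
  by near: s; exact: H2.
rewrite distrC => /(le_trans (lerB_dist _ _)).
rewrite normrZ normfV lerBlDr ler_pdivrMl ?normr_gt0// [1 + _]addrC => h.
by rewrite mulrAC ler_pdivrMr// mulrAC [leRHS]mulrC ler_pM2l.
Unshelve. all: by end_near. Qed.

(** * C^1 paths: velocity, continuity, pull-back of forms *)

Section Paths.
Context {R : realType}.
Local Notation C := R[i].
Local Notation V m := ('rV[C]_m : normedModType C).
Implicit Types (m : nat) (t : R).

(** The parameter is real while C^m is normed over C, so the quotient is formed with the scalars
    [s%:C] and its limit is assembled from the real derivatives of the two parts of each
    coordinate. *)
Lemma C1_path_quotient m (c : R -> 'rV[C]_m) t : C1_path c ->
  ((s%:C)^-1 *: (c (s + t) - c t)) @[s --> 0^'] --> (velocity c t : V m).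
Proof.
move=> C1; apply: cvg_rV => j; have [cr ci _ _] := C1 j.
have quot (u : R -> R) : derivable u t 1 ->
    s^-1 * (u (s + t) - u t) @[s --> 0^'] --> u^`()%classic t.
  move=> du; rewrite derive1E.
  have -> : (fun s => s^-1 * (u (s + t) - u t)) =
      (fun h => h^-1 *: ((u \o shift t) (h *: 1) - u t)).
    by apply/funext => h; rewrite /= /GRing.scale/= mulr1.
  exact: du.
rewrite mxE; apply: cvg_complex => /=.
- have -> : (fun s : R => complex.Re (((s%:C)^-1 *: (c (s + t) - c t)) 0 j)) =
      (fun s => s^-1 * (re_coord c j (s + t) - re_coord c j t)).
    apply/funext => s; rewrite -fmorphV !mxE /re_coord.
    by case: (c (s + t) 0 j) => a b; case: (c t 0 j) => a' b' /=; rewrite mul0r subr0.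
  exact: quot.
- have -> : (fun s : R => complex.Im (((s%:C)^-1 *: (c (s + t) - c t)) 0 j)) =
      (fun s => s^-1 * (im_coord c j (s + t) - im_coord c j t)).
    apply/funext => s; rewrite -fmorphV !mxE /im_coord.
    by case: (c (s + t) 0 j) => a b; case: (c t 0 j) => a' b' /=; rewrite mul0r addr0.
  exact: quot.
Qed.

Lemma C1_path_continuous m (c : R -> 'rV[C]_m) t : C1_path c ->
  c s @[s --> t] --> (c t : V m).
Proof.
move=> C1; apply: cvg_rV => j; have [cr ci _ _] := C1 j.
apply: cvg_complex.
- by apply: (@differentiable_continuous _ _ _ t (re_coord c j)); apply/derivable1_diffP.
- by apply: (@differentiable_continuous _ _ _ t (im_coord c j)); apply/derivable1_diffP.
Qed.

Lemma velocity_continuous m (c : R -> 'rV[C]_m) t j : C1_path c ->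
  (velocity c s 0 j : C^o) @[s --> t] --> (velocity c t 0 j : C^o).
Proof.
move=> C1; have [_ _ cr ci] := C1 j.
apply: cvg_complex.
- rewrite mxE /=.
  by under eq_fun do rewrite mxE /=; exact: cr.
- rewrite mxE /=.
  by under eq_fun do rewrite mxE /=; exact: ci.
Qed.

Definition continuous_form_at m (w : @Defs.form R m) (z : 'rV[C]_m) : Prop :=
  forall j, {for (z : V m), continuous (fun x : V m => w x 0 j : C^o)}.

Lemma pullback_continuous m (w : @Defs.form R m) (c : R -> 'rV[C]_m) t :
  C1_path c -> continuous_form_at w (c t) ->
  (pullback w c s : C^o) @[s --> t] --> (pullback w c t : C^o).
Proof.
move=> C1 cw; rewrite /pullback.
apply: (@cvg_sumr C C^o) => j.
apply: cvgM; last exact: velocity_continuous.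
have := cvg_comp _ _ (C1_path_continuous C1) (cw j); exact.
Qed.

End Paths.

(** * Path integrals: integrability, locality, additivity *)

Section PathIntegrals.
Context {R : realType}.
Local Notation C := R[i].
Local Notation V m := ('rV[C]_m : normedModType C).
Local Notation mu := (@lebesgue_measure R).

Lemma pullback_integrable m (w : @Defs.form R m) (c : R -> 'rV[C]_m) :
  C1_path c -> along c (continuous_form_at w) ->
  mu.-integrable `[0, 1] (EFin \o (fun t => complex.Re (pullback w c t))) /\
  mu.-integrable `[0, 1] (EFin \o (fun t => complex.Im (pullback w c t))).
Proof.
move=> C1 cw.
split; apply: continuous_compact_integrable; try exact: segment_compact;
  apply: continuous_in_subspaceT => t;
  rewrite inE /= in_itv /= => t01; [apply: cvg_Re|apply: cvg_Im];
  apply: pullback_continuous => //; exact: cw.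
Qed.

(** The integral sees a form only on the path; this allows a form to be replaced by an explicit
    formula that is valid only away from its poles. *)
Lemma path_integral_eq m (P : 'rV[C]_m -> Prop) (w w' : @Defs.form R m)
    (c : R -> 'rV[C]_m) :
  along c P -> (forall z, P z -> w z = w' z) ->
  path_integral w c = path_integral w' c.
Proof.
move=> cP ww'; rewrite /path_integral.
by congr (_ +i* _); apply: eq_Rintegral => t;
  rewrite inE /= in_itv /= => t01; rewrite /pullback ww'//; exact: cP.
Qed.

Lemma path_integralB m (w w' : @Defs.form R m) (c : R -> 'rV[C]_m) :
  C1_path c -> along c (continuous_form_at w) -> along c (continuous_form_at w') ->
  path_integral (fun z => - w z + w' z) c =
  - path_integral w c + path_integral w' c.
Proof.
move=> C1 /(pullback_integrable C1)[wr wi] /(pullback_integrable C1)[w'r w'i].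
have pB t : pullback (fun z => - w z + w' z) c t = pullback w' c t - pullback w c t.
  rewrite /pullback -sumrB; apply: eq_bigr => j _.
  by rewrite !mxE mulrDl mulNr addrC.
rewrite /path_integral addrC.
under eq_Rintegral do rewrite pB raddfB /=.
under [X in _ +i* X]eq_Rintegral do rewrite pB raddfB /=.
by rewrite !RintegralB.
Qed.

(** Paths are defined on the whole line, so the derivatives may be taken two-sided at 0 and 1; the
    one-sided continuity at the end points follows by restriction. *)
Lemma Rintegral_FTC (u u' : R -> R) :
  (forall t : R, 0 <= t <= 1 -> is_derive t (1 : R) u (u' t)) ->
  (forall t : R, 0 <= t <= 1 -> {for t, continuous u'}) ->
  \int[mu]_(t in `[0, 1]) u' t = u 1 - u 0.
Proof.
move=> du cu'.
have cu (t : R) : 0 <= t <= 1 -> u s @[s --> t] --> u t.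
  move=> /du dut; apply: (@differentiable_continuous _ _ _ t u).
  exact/derivable1_diffP.
rewrite /Rintegral (@continuous_FTC2 _ _ u) //.
- apply: continuous_in_subspaceT => t.
  by rewrite inE /= in_itv /=; exact: cu'.
- split.
  + move=> t; rewrite in_itv /= => /andP[t0 t1].
    by have := du t; rewrite !ltW// => /(_ isT) [].
  + by apply/cvg_at_right_filter/cu; rewrite lexx ler01.
  + by apply/cvg_at_left_filter/cu; rewrite lexx ler01.
- move=> t; rewrite in_itv /= => /andP[t0 t1].
  by have := du t; rewrite !ltW// => /(_ isT) [_]; rewrite derive1E.
Qed.

(** * The integral of a form along a path that stays where the form has a primitive *)

Section FundamentalTheorem.
Variables (m : nat) (P : 'rV[C]_m -> Prop) (c : R -> 'rV[C]_m).
Variables (f : 'rV[C]_m -> C^o) (w : @Defs.form R m).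
Hypotheses (C1 : C1_path c) (cP : along c P).
Hypothesis fdiff : forall z, P z -> differentiable f (z : V m).
Hypothesis fw : forall z j, P z -> partial j f z = w z 0 j.
Hypothesis wcont : forall z, P z -> continuous_form_at w z.

(** Here [cvg_chain] is used with the real increment seen in C as scalar; the real and imaginary
    parts of this limit are the real derivatives needed for the fundamental theorem. *)
Lemma cvg_quotient_along t : P (c t) ->
  ((s%:C)^-1 * (f (c (s + t)) - f (c t)) : C^o) @[s --> 0^'] -->
  (pullback w c t : C^o).
Proof.
move=> Pt.
have -> : pullback w c t =
    \sum_j 'D_(delta_mx 0 j) f (c t : V m) * velocity c t 0 j.
  by apply: eq_bigr => j _; rewrite -fw.
apply: cvg_chain => //.
- exact: fdiff.
- near=> s; rewrite fmorph_eq0.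
  near: s; exact: nbhs_dnbhs_neq.
- apply: cvg_comp (@C1_path_continuous _ _ c t C1).
  have : x + t @[x --> (0 : R)^'] --> 0 + t.
    by apply: cvgD; [exact: cvg_within|exact: cvg_cst].
  by rewrite add0r.
- exact: C1_path_quotient.
Unshelve. all: by end_near. Qed.

Lemma is_derive_Re t : P (c t) ->
  is_derive t (1 : R) (fun s => complex.Re (f (c s))) (complex.Re (pullback w c t)).
Proof.
move=> Pt; have cq := cvg_Re (cvg_quotient_along Pt).
have dq : h^-1 *: (((fun s => complex.Re (f (c s))) \o shift t) (h *: 1)
    - complex.Re (f (c t))) @[h --> (0 : R)^'] --> complex.Re (pullback w c t).
  rewrite (_ : (fun h => _) =
    (fun h => complex.Re ((h%:C)^-1 * (f (c (h + t)) - f (c t))))).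
    exact: cq.
  apply/funext => h; rewrite /= /GRing.scale/= mulr1 -fmorphV.
  case: (f (c (h + t))) => a b; case: (f (c t)) => a' b' /=.
  by rewrite mul0r subr0.
by apply: DeriveDef; [apply/cvg_ex; eexists; exact: dq|exact: cvg_lim dq].
Qed.

Lemma is_derive_Im t : P (c t) ->
  is_derive t (1 : R) (fun s => complex.Im (f (c s))) (complex.Im (pullback w c t)).
Proof.
move=> Pt; have cq := cvg_Im (cvg_quotient_along Pt).
have dq : h^-1 *: (((fun s => complex.Im (f (c s))) \o shift t) (h *: 1)
    - complex.Im (f (c t))) @[h --> (0 : R)^'] --> complex.Im (pullback w c t).
  rewrite (_ : (fun h => _) =
    (fun h => complex.Im ((h%:C)^-1 * (f (c (h + t)) - f (c t))))).
    exact: cq.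
  apply/funext => h; rewrite /= /GRing.scale/= mulr1 -fmorphV.
  case: (f (c (h + t))) => a b; case: (f (c t)) => a' b' /=.
  by rewrite mul0r addr0.
by apply: DeriveDef; [apply/cvg_ex; eexists; exact: dq|exact: cvg_lim dq].
Qed.

Lemma path_integral_FTC : path_integral w c = f (c 1) - f (c 0).
Proof.
have pc (t : R) : 0 <= t <= 1 -> (pullback w c s : C^o) @[s --> t] --> (pullback w c t : C^o).
  by move=> /cP Pt; apply: pullback_continuous => //; exact: wcont.
have dRe (t : R) (t01 : 0 <= t <= 1) := is_derive_Re (cP t01).
have dIm (t : R) (t01 : 0 <= t <= 1) := is_derive_Im (cP t01).
have cRe (t : R) : 0 <= t <= 1 -> {for t, continuous (fun s => complex.Re (pullback w c s))}.
  by move=> /pc; exact: cvg_Re.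
have cIm (t : R) : 0 <= t <= 1 -> {for t, continuous (fun s => complex.Im (pullback w c s))}.
  by move=> /pc; exact: cvg_Im.
rewrite /path_integral (Rintegral_FTC dRe cRe) (Rintegral_FTC dIm cIm).
by case: (f (c 1)) => a b; case: (f (c 0)) => a' b'.
Qed.

End FundamentalTheorem.
End PathIntegrals.

(** * Complex differentiability of the exponential *)

Section ComplexExponential.
Context {R : realType}.
Local Notation C := R[i].

Lemma cexpD (z w : C) : cexp (z + w) = cexp z * cexp w.
Proof.
case: z => a b; case: w => a' b'.
rewrite /cexp /= expRD sinD cosD; apply/eqP; rewrite eq_complex /=.
apply/andP; split; apply/eqP; ring.
Qed.

Lemma cexp0 : cexp (0 : C) = 1.
Proof. by rewrite /cexp /= expR0 cos0 sin0 mulr1 mulr0. Qed.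

Lemma cexp_neq0 (z : C) : cexp z != 0.
Proof.
apply/eqP => z0; have := cexpD z (- z).
by rewrite subrr z0 mul0r cexp0 => /eqP; rewrite oner_eq0.
Qed.

Lemma is_derive0_near (u : R -> R) (d : R) : is_derive (0 : R) (1 : R) u d ->
  forall e, 0 < e -> \forall x \near (0 : R), `|u x - u 0 - x * d| <= e * `|x|.
Proof.
move=> du e e0; have du' : derivable u 0 1 by [].
have /eqaddoP/(_ _ e0) := derivable_nbhs du'.
apply: filterS => x; rewrite !fctE /= addr0 derive_val.
by rewrite /GRing.scale/= mulr1 opprD addrA.
Qed.

(** The real part of the remainder is e^x (cos y - 1) + (e^x - 1 - x) and the imaginary part e^x
    (sin y - y) + (e^x - 1) y. With e^x <= 2 these are at most 2d|y| + d|x| and 3d|y|, whose sum is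
    at most 6d times the modulus of x + iy. *)
Lemma cexp_remainder (d x y : R) : 0 < d -> d <= 1 ->
  `|expR x - 1 - x| <= d * `|x| -> `|expR x - 1| <= d ->
  `|cos y - 1| <= d * `|y| -> `|sin y - y| <= d * `|y| ->
  `|cexp (x +i* y) - 1 - (x +i* y)| <= (d * 6)%:C * `|x +i* y|.
Proof.
move=> d0 d1 h1 h2 h3 h4.
have xu : `|x|%:C <= `|x +i* y| := normc_ge_Re (x +i* y).
have yu : `|y|%:C <= `|x +i* y|.
  have := normc_ge_Re ((x +i* y) * 'i%C).
  by rewrite normrM ReiNIm normrN complexiE normCi mulr1.
have E : expR x <= 2.
  by move: h2; rewrite ler_distl => /andP[_ /le_trans]; apply; lra.
have hr : `|complex.Re (cexp (x +i* y) - 1 - (x +i* y))| <= 2 * d * `|y| + d * `|x|.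
  rewrite /cexp /=.
  have -> : expR x * cos y - 1 - x = expR x * (cos y - 1) + (expR x - 1 - x) by ring.
  apply: le_trans (ler_normD _ _) _; apply: lerD => //.
  by rewrite normrM (ger0_norm (expR_ge0 _)) -mulrA ler_pM// expR_ge0.
have hi : `|complex.Im (cexp (x +i* y) - 1 - (x +i* y))| <= 2 * d * `|y| + d * `|y|.
  rewrite /cexp /=.
  have -> : expR x * sin y - 0 - y = expR x * (sin y - y) + (expR x - 1) * y by ring.
  apply: le_trans (ler_normD _ _) _; apply: lerD.
    by rewrite normrM (ger0_norm (expR_ge0 _)) -mulrA ler_pM// expR_ge0.
  by rewrite normrM ler_wpM2r.
apply: le_trans (normc_le_ReIm _) _.
apply: (@le_trans _ _ (5 * d * `|y| + d * `|x|)%:C).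
  by rewrite lecR; apply: le_trans (lerD hr hi) _; lra.
have -> : (d * 6)%:C = (5 * d)%:C + d%:C :> C by rewrite -rmorphD; congr _%:C; ring.
have -> : (5 * d * `|y| + d * `|x|)%:C = (5 * d)%:C * `|y|%:C + d%:C * `|x|%:C :> C.
  by rewrite rmorphD !rmorphM.
rewrite (mulrDl (5 * d)%:C).
by apply: lerD; apply: ler_wpM2l => //; rewrite ler0c ?mulr_ge0 ?ltW.
Qed.

Lemma cexp_near0 (e : R) : 0 < e ->
  \forall u \near (0 : C^o), `|cexp u - 1 - u| <= e%:C * `|u|.
Proof.
(* The 6 is the constant of [cexp_remainder], and d <= 1 is what ensures e^x <= 2 there. *)
move=> e0; pose d := Num.min (e / 6) 1.
have d0 : 0 < d by rewrite lt_min ltr01 divr_gt0.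
have [de d1] : d <= e / 6 /\ d <= 1 by split; rewrite ge_min lexx ?orbT.
have id0 : (id u : C^o) @[u --> (0 : C^o)] --> (0 : C^o) by exact: cvg_id.
have reN (P : R -> Prop) : (\forall x \near (0 : R), P x) ->
    \forall u \near (0 : C^o), P (complex.Re u).
  by move=> Px; exact: (cvg_Re id0 Px).
have imN (P : R -> Prop) : (\forall x \near (0 : R), P x) ->
    \forall u \near (0 : C^o), P (complex.Im u).
  by move=> Px; exact: (cvg_Im id0 Px).
have dexp := reN _ (is_derive0_near (is_derive_expR (0 : R)) d0).
have dcos := imN _ (is_derive0_near (is_derive_cos (0 : R)) d0).
have dsin := imN _ (is_derive0_near (is_derive_sin (0 : R)) d0).
have cexpR : \forall x \near (0 : R), `|expR x - 1| <= d.
  have /cvgrPdistC_le/(_ _ d0) := @continuous_expR R 0.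
  by rewrite expR0.
have {}cexpR := reN _ cexpR.
near=> u.
have -> : u = complex.Re u +i* complex.Im u by case: (u).
apply: le_trans (cexp_remainder d0 d1 _ _ _ _) _.
- have : `|expR (complex.Re u) - expR 0 - complex.Re u * expR 0| <= d * `|complex.Re u|.
    by near: u.
  by rewrite expR0 mulr1.
- by near: u.
- have : `|cos (complex.Im u) - cos 0 - complex.Im u * - sin 0| <= d * `|complex.Im u|.
    by near: u.
  by rewrite cos0 sin0 oppr0 mulr0 subr0.
- have : `|sin (complex.Im u) - sin 0 - complex.Im u * cos 0| <= d * `|complex.Im u|.
    by near: u.
  by rewrite cos0 sin0 mulr1 subr0.
- by rewrite ler_wpM2r// lecR -ler_pdivlMr.
Unshelve. all: by end_near. Qed.

(** Only affineness of [l] along the line through [x] in direction [v] matters: by [cexpD] the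
    factor [cexp (l x)] comes out and the expansion at 0 remains. *)
Lemma is_derive_cexp m (l : 'rV[C]_m -> C) (a : C) (x v : 'rV[C]_m) :
  (forall h : C, l (h *: v + x) = h * a + l x) ->
  is_derive (x : ('rV[C]_m : normedModType C)) v (fun y => cexp (l y) : C^o) (cexp (l x) * a).
Proof.
move=> la.
have cq : h^-1 *: (((fun y => cexp (l y) : C^o) \o shift x) (h *: v) - cexp (l x) : C^o)
    @[h --> (0 : C^o)^'] --> (cexp (l x) * a : C^o).
  rewrite (_ : (fun h => _) =
    (fun h => (cexp (l x) * (h^-1 * (cexp (h * a) - 1)) : C^o))); last first.
    apply/funext => h; rewrite /= la cexpD /GRing.scale /=; ring.
  apply: (@cvgM C); first exact: cvg_cst.
  have ha : (h * a : C^o) @[h --> (0 : C^o)^'] --> (0 : C^o).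
    have : (h * a : C^o) @[h --> (0 : C^o)^'] --> (0 * a : C^o).
      by apply: (@cvgM C); [exact: cvg_within|exact: cvg_cst].
    by rewrite mul0r.
  apply/cvgrPdist_le => e e0.
  (* Adding 1 keeps the denominator nonzero when [a] is 0. *)
  have a1 : 0 < `|a| + 1 by rewrite ltr_wpDl.
  have : 0 < e / (`|a| + 1) by rewrite divr_gt0.
  set d := e / _ => d0.
  have [dr di] : 0 < complex.Re d /\ complex.Im d = 0.
    by move: d0; rewrite ltcE /= => /andP[/eqP-> ].
  have dE : (complex.Re d)%:C = d by rewrite [RHS]complexE di mulr0 addr0.
  have H : \forall h \near (0 : C^o)^', `|cexp (h * a) - 1 - h * a| <= d * `|h * a|.
    by have := ha _ (cexp_near0 dr); rewrite dE; exact.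
  near=> h.
  have h0 : (h : C^o) != 0 by near: h; exact: (@nbhs_dnbhs_neq C^o).
  have : `|cexp (h * a) - 1 - h * a| <= d * `|h * a| by near: h.
  rewrite distrC normrM mulrCA => hb.
  rewrite -[X in X - _](mulKf h0) -mulrBr normrM normfV ler_pdivrMl ?normr_gt0//.
  apply: le_trans hb _; rewrite ler_pM2l ?normr_gt0// /d mulrAC ler_pdivrMr//.
  by rewrite ler_pM2l// lerDl.
by apply: DeriveDef; [apply/cvg_ex; eexists; exact: cq|exact: cvg_lim cq].
Unshelve. all: by end_near. Qed.

End ComplexExponential.

(** * A calculus of directional logarithmic derivatives *)

Section LogarithmicDerivative.
Variables (K : numFieldType) (V : normedModType K).
Implicit Types (f : V -> K^o) (x v : V) (d : K).

(** The nonvanishing is bundled with the derivative so that both pass together through products and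
    inverses, where [d] is additive. *)
Definition is_dlog x v f d : Prop := f x != 0 /\ is_derive x v f (f x * d).

Lemma is_dlog_val x v f d : is_dlog x v f d -> 'D_v f x / f x = d.
Proof. by move=> [f0 df]; rewrite derive_val mulrAC divff// mul1r. Qed.

Lemma is_dlog_unique x v f d d' : is_dlog x v f d -> is_dlog x v f d' -> d = d'.
Proof. by move=> /is_dlog_val <- /is_dlog_val. Qed.

Lemma is_dlog_cst x v (a : K) : a != 0 -> is_dlog x v (fun=> a) 0.
Proof. by move=> a0; split => //; rewrite mulr0; exact: is_derive_cst. Qed.

Lemma is_dlogM x v f g d e : is_dlog x v f d -> is_dlog x v g e ->
  is_dlog x v (fun y => f y * g y) (d + e).
Proof.
move=> [f0 df] [g0 dg]; split; first by rewrite mulf_neq0.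
apply: (@is_derive_eq _ _ _ (f * g)); rewrite /GRing.scale /=; ring.
Qed.

Lemma is_dlogV x v f d : is_dlog x v f d -> is_dlog x v (fun y => (f y)^-1) (- d).
Proof.
move=> [f0 df]; split; first by rewrite invr_eq0.
have df' : derivable f x v by [].
apply: DeriveDef; first exact: derivableV.
rewrite deriveV// derive_val /GRing.scale /=; field; exact: f0.
Qed.

End LogarithmicDerivative.

(** As [phi] is affine along the line considered, the difference quotients on both sides are equal,
    and no differentiability of [phi] enters. *)
Lemma is_dlog_comp (K : numFieldType) (V W : normedModType K) (phi : W -> V)
    (y w : W) (v : V) (f : V -> K^o) (d : K) :
  (forall h, phi (h *: w + y) = h *: v + phi y) ->
  is_dlog (phi y) v f d -> is_dlog y w (fun z => f (phi z)) d.
Proof.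
move=> phiE [f0 df]; split => //.
have E : (fun h => h^-1 *: (((fun z => f (phi z)) \o shift y) (h *: w) - f (phi y))) =
    (fun h => h^-1 *: ((f \o shift (phi y)) (h *: v) - f (phi y))).
  by apply/funext => h /=; rewrite phiE.
apply: DeriveDef; rewrite /derivable/= /derive ?E; first by case: df.
by case: df.
Qed.


(** * Logarithmic derivatives of theta, of F_q and of the torus coordinates of G *)

Section ThetaFunctions.
Context {R : realType}.
Local Notation C := R[i].
Local Notation V m := ('rV[C]_m : normedModType C).

Lemma is_dlog_cexp m (l : 'rV[C]_m -> C) (a : C) (x v : V m) :
  (forall k : C, l (k *: v + x) = k * a + l x) ->
  is_dlog x v (fun y => cexp (l y)) a.
Proof. by move=> la; split; [exact: cexp_neq0|exact: is_derive_cexp]. Qed.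

Variables (g : nat) (theta : 'rV[C]_g -> C^o).
Hypothesis theta_entire : entire theta.
Implicit Types (z v q : V g).

Lemma theta_differentiable z : differentiable theta z.
Proof. by have [] := theta_entire 1. Qed.

Lemma dtheta_differentiable j z : differentiable (partial j theta) z.
Proof. by have [_ /(_ j)[]] := theta_entire 2. Qed.

Lemma ddtheta_differentiable j k z :
  differentiable (partial k (partial j theta)) z.
Proof. by have [_ /(_ j)[_ /(_ k)[]]] := theta_entire 3. Qed.

Lemma hE j z : h theta j z = partial j theta z / theta z.
Proof. by rewrite /h /dlog mxE. Qed.

Lemma is_dlog_theta z v : theta z != 0 ->
  is_dlog z v theta (\sum_j h theta j z * v 0 j).
Proof.
move=> z0; split => //.
have dth : derivable theta z v by apply: diff_derivable; exact: theta_differentiable.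
apply: DeriveDef => //; rewrite deriveE; last exact: theta_differentiable.
rewrite differential_sum; last exact: theta_differentiable.
rewrite mulr_sumr; apply: eq_bigr => j _.
by rewrite hE mulrCA mulrA divfK.
Qed.

Lemma is_dlog_theta_shift q z v : theta (z + q) != 0 ->
  is_dlog z v (fun y => theta (y + q)) (\sum_j h theta j (z + q) * v 0 j).
Proof.
move=> zq0; apply: (@is_dlog_comp _ _ _ (fun y => y + q)); last exact: is_dlog_theta.
by move=> k; rewrite addrA.
Qed.

(** The coefficients of d log F_q: the quotient of theta values gives the first two terms, the
    exponential factor of F_q the third. *)
Definition xi_coef q : @Defs.form R g :=
  fun z => \row_j (h theta j (z + q) - h theta j z - h theta j q).

Lemma is_dlog_F q z v : theta z != 0 -> theta q != 0 -> theta (z + q) != 0 ->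
  is_dlog z v (F theta q) (\sum_j xi_coef q z 0 j * v 0 j).
Proof.
move=> z0 q0 zq0.
(* The sum is arranged in the order of the factors of F_q; the 0 is the contribution of the constant
   [theta q]. *)
rewrite (_ : \sum_j _ = \sum_j h theta j (z + q) * v 0 j +
    - (\sum_j h theta j z * v 0 j + 0) + - \sum_j h theta j q * v 0 j); last first.
  rewrite addr0 -!sumrB; apply: eq_bigr => j _; rewrite mxE; ring.
apply: is_dlogM.
  apply: is_dlogM; first exact: is_dlog_theta_shift.
  by apply/is_dlogV/is_dlogM; [exact: is_dlog_theta|exact: is_dlog_cst].
apply: is_dlog_cexp => k; rewrite mulrN -opprD mulr_sumr -big_split /=.
by congr (- _); apply: eq_bigr => j _; rewrite !mxE; ring.
Qed.

Lemma xiE q z : theta z != 0 -> theta q != 0 -> theta (z + q) != 0 ->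
  xi theta q z = xi_coef q z.
Proof.
move=> z0 q0 zq0; apply/rowP => j; rewrite mxE.
rewrite (is_dlog_val (is_dlog_F (delta_mx 0 j) z0 q0 zq0)).
rewrite (bigD1 j)//= big1 ?addr0 => [|k kj]; first by rewrite [delta_mx _ _ _ _]mxE !eqxx mulr1.
by rewrite [delta_mx _ _ _ _]mxE (negbTE kj) andbF mulr0.
Qed.

Section Extension.
Variables (s : nat) (q : 'I_s -> 'rV[C]_g).
Hypothesis q0 : forall k, theta (q k) != 0.

Lemma is_dlog_G_coord k (x v : V (g + s)) : G_regular theta q x ->
  is_dlog x v (G_coord theta q k)
    (rsubmx v 0 k + \sum_j xi_coef (q k) (lsubmx x) 0 j * lsubmx v 0 j).
Proof.
move=> [x0 xq0]; apply: is_dlogM.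
  by apply: is_dlog_cexp => c; rewrite !mxE.
apply: (@is_dlog_comp _ _ _ lsubmx); last exact: is_dlog_F.
by move=> c; rewrite linearP.
Qed.

(** The second block is dt_k, coming from the factor e^(t_k) of the k-th torus coordinate. *)
Definition xi_tilde_coef k : @Defs.form R (g + s) :=
  fun x => row_mx (xi_coef (q k) (lsubmx x)) (delta_mx 0 k).

Lemma xi_tildeE k (x : 'rV[C]_(g + s)) : G_regular theta q x ->
  xi_tilde theta q k x = xi_tilde_coef k x.
Proof.
move=> xr; apply/rowP => j; rewrite mxE (is_dlog_val (is_dlog_G_coord k _ xr)).
case: (split_ordP j) => i ->.
  rewrite row_mxEl (bigD1 i)//= big1 => [|k' k'i].
    by rewrite !mxE !eqxx addr0 mulr1 eq_rlshift andbF add0r.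
  by rewrite [lsubmx _ _ _]mxE [delta_mx _ _ _ _]mxE eq_lshift (negbTE k'i) andbF mulr0.
rewrite row_mxEr big1 => [|k' _].
  by rewrite !mxE addr0 eq_rshift eq_sym.
by rewrite [lsubmx _ _ _]mxE [delta_mx _ _ _ _]mxE eq_lrshift andbF mulr0.
Qed.

End Extension.

End ThetaFunctions.

(** * Integrals of the differentials of the three kinds *)

Section ThetaIntegrals.
Context {R : realType}.
Local Notation C := R[i].
Local Notation V m := ('rV[C]_m : normedModType C).

Lemma continuous_form_row g s (w : @Defs.form R g) (b : 'rV[C]_s) (x : 'rV[C]_(g + s)) :
  continuous_form_at w (lsubmx x) ->
  continuous_form_at (fun y => row_mx (w (lsubmx y)) b) x.
Proof.
move=> cw j; case: (split_ordP j) => i ->.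
- rewrite (_ : (fun y => _) = (fun y : V (g + s) => w (lsubmx y) 0 i : C^o)).
    have cl : lsubmx y @[y --> (x : V (g + s))] --> (lsubmx x : V g).
      apply: (@differentiable_continuous _ _ _ x (@lsubmx C 1 g s)).
      exact: differentiable_lsubmx.
    by have := cvg_comp _ _ cl (cw i); exact.
  by apply/funext => y; rewrite row_mxEl.
- rewrite (_ : (fun y => _) = (fun=> b 0 i : C^o)).
    exact: cst_continuous.
  by apply/funext => y; rewrite row_mxEr.
Qed.

Lemma path_integral_omega g (j : 'I_g) (c : R -> 'rV[C]_g) : C1_path c ->
  path_integral (omega j) c = (c 1 - c 0) 0 j.
Proof.
move=> C1; rewrite !mxE.
have dj (z : V g) : differentiable (fun z : V g => z 0 j : C^o) z.
  exact: differentiable_coord.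
rewrite (@path_integral_FTC _ _ (fun=> True) c (fun z => z 0 j)) //.
  move=> z i _; rewrite /partial /omega.
  have <- : (delta_mx 0 i : 'rV[C]_g) 0 j = (delta_mx 0 j : 'rV[C]_g) 0 i.
    by rewrite !mxE eq_sym.
  apply: (@derive_val _ _ _ _ _ (fun z : V g => z 0 j : C^o)).
  have cq : h^-1 *: (((fun z : V g => z 0 j : C^o) \o shift z) (h *: (delta_mx 0 i : V g)) - z 0 j)
      @[h --> (0 : C^o)^'] --> ((delta_mx 0 i : 'rV[C]_g) 0 j : C^o).
    apply: cvg_near_cst; near=> h => /=.
    have h0 : (h : C^o) != 0 by near: h; exact: (@nbhs_dnbhs_neq C^o).
    by rewrite !mxE addrK /GRing.scale/= mulKf.
  by apply: DeriveDef; [apply/cvg_ex; eexists; exact: cq|exact: cvg_lim cq].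
by move=> z _ i; rewrite /omega; exact: cst_continuous.
Unshelve. all: by end_near. Qed.

Variables (g : nat) (theta : 'rV[C]_g -> C^o).
Hypothesis theta_entire : entire theta.
Implicit Types (z v q : V g).

Let theta_diff := theta_differentiable theta_entire.
Let dtheta_diff := dtheta_differentiable theta_entire.
Let ddtheta_diff := ddtheta_differentiable theta_entire.

Lemma h_quotient j :
  h theta j = (partial j theta : V g -> C) * (fun z => (theta z)^-1).
Proof. by apply/funext => z; rewrite hE. Qed.

Lemma h_differentiable j z : theta z != 0 -> differentiable (h theta j) z.
Proof.
move=> z0; rewrite h_quotient; apply: differentiableM; first exact: dtheta_diff.
exact: differentiableV.
Qed.

Lemma h_continuous j z : theta z != 0 -> {for z, continuous (h theta j : V g -> C^o)}.
Proof. by move=> z0; apply: differentiable_continuous; exact: h_differentiable. Qed.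

Lemma xi_coef_continuous q z : theta z != 0 -> theta (z + q) != 0 ->
  continuous_form_at (xi_coef theta q) z.
Proof.
move=> z0 zq0 j.
rewrite (_ : (fun y => _) =
  (fun y : V g => h theta j (y + q) - h theta j y - h theta j q : C^o)); last first.
  by apply/funext => y; rewrite mxE.
apply: (@cvgB _ _ _ (nbhs z)); last exact: cvg_cst.
apply: (@cvgB _ _ _ (nbhs z)); last exact: h_continuous.
have cq : (y + q : V g) @[y --> (z : V g)] --> (z + q : V g).
  by apply: (@cvgD _ _ _ (nbhs z)); [exact: cvg_id|exact: cvg_cst].
by have := cvg_comp _ _ cq (@h_continuous j _ zq0); exact.
Qed.

(** The quotient rule for h_j, written out so that continuity off the zeros of theta can be read
    from that of the derivatives of theta. *)
Definition eta_coef j : @Defs.form R g := fun z =>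
  \row_k (partial k (partial j theta) z / theta z -
          partial j theta z * partial k theta z / theta z ^+ 2).

Lemma partial_h j k z : theta z != 0 -> partial k (h theta j) z = eta_coef j z 0 k.
Proof.
move=> z0; rewrite mxE /partial h_quotient.
have dth := @diff_derivable _ _ _ _ _ (delta_mx 0 k : V g) (theta_diff z).
have ddth := @diff_derivable _ _ _ _ _ (delta_mx 0 k : V g) (dtheta_diff j z).
have dV := derivableV z0 dth.
have -> := deriveM ddth dV.
have -> := deriveV z0 dth.
rewrite -[_ *: _]/(_ * _) -[X in _ + X]/(_ * _).
rewrite addrC mulrC; congr (_ + _).
by rewrite /GRing.scale /= mulNr mulrN mulrA mulrAC.
Qed.

Lemma eta_coef_continuous j z : theta z != 0 -> continuous_form_at (eta_coef j) z.
Proof.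
move=> z0 k.
rewrite (_ : (fun y => _) = (fun y : V g => partial k (partial j theta) y / theta y -
  partial j theta y * partial k theta y / (theta y * theta y) : C^o)); last first.
  by apply/funext => y; rewrite mxE expr2.
have c0 := differentiable_continuous (theta_diff z).
have cj i := differentiable_continuous (dtheta_diff i z).
have cjk := differentiable_continuous (ddtheta_diff j k z).
apply: (@cvgB _ _ _ (nbhs z)).
  exact: (@cvgM C _ (nbhs z) _ _ _ _ _ cjk (@cvgV C _ (nbhs z) _ _ _ z0 c0)).
apply: (@cvgM C _ (nbhs z)).
  exact: (@cvgM C _ (nbhs z) _ _ _ _ _ (cj j) (cj k)).
have z2 : theta z * theta z != 0 by rewrite mulf_neq0.
exact: (@cvgV C _ (nbhs z) _ _ _ z2 (@cvgM C _ (nbhs z) _ _ _ _ _ c0 c0)).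
Qed.

Lemma path_integral_eta j v (c : R -> 'rV[C]_g) : path_by theta v c ->
  path_integral (Defs.eta theta j) c = h theta j (c 1) - h theta j (c 0).
Proof.
move=> [C1 c0 _].
rewrite (@path_integral_eq _ _ _ _ (eta_coef j) _ c0) => [|z z0].
  apply: path_integral_FTC c0 _ _ _ => // z z0; first exact: h_differentiable.
  - by move=> k; exact: partial_h.
  - exact: eta_coef_continuous.
by apply/rowP => k; rewrite mxE partial_h.
Qed.

(** Splitting the integral requires both terms to be integrable; this comes from replacing them by
    their explicit coefficients, which are continuous on the regular domain. *)
Lemma path_integral_xi_G s (q : 'I_s -> 'rV[C]_g) k (c : R -> 'rV[C]_(g + s)) :
  (forall k, theta (q k) != 0) -> C1_path c -> along c (G_regular theta q) ->
  path_integral (xi_G theta q k) c =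
  - path_integral (xi_tilde theta q k) c
  + path_integral (pull_pi (xi theta (q k))) c.
Proof.
move=> q0 C1 cr.
have pE x : G_regular theta q x ->
    pull_pi (s := s) (xi theta (q k)) x = pull_pi (xi_coef theta (q k)) x.
  by move=> [x0 xq]; rewrite /pull_pi xiE.
rewrite (path_integral_eq cr (xi_tildeE theta_entire q0 k)) (path_integral_eq cr pE).
have xc : along c (fun x => continuous_form_at (xi_coef theta (q k)) (lsubmx x)).
  by move=> t /cr [x0 xq]; exact: xi_coef_continuous.
have c1 : along c (continuous_form_at (xi_tilde_coef theta q k)).
  by move=> t /xc; exact: continuous_form_row.
have c2 : along c (continuous_form_at (pull_pi (xi_coef theta (q k)))).
  by move=> t /xc; exact: continuous_form_row.
rewrite -(path_integralB C1 c1 c2).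
by apply: (path_integral_eq cr) => x xr; rewrite /xi_G xi_tildeE// pE.
Qed.

End ThetaIntegrals.

(** * Quasi-periods of the eta_j and periods of xi^G *)

Section QuasiPeriods.
Context {R : realType} {g : nat}.
Local Notation C := R[i].
Local Notation V m := ('rV[C]_m : normedModType C).
Variables (A : @ppav R g).
Implicit Types (z v l : V g).

Lemma H_sum_delta z l : H A z l = \sum_j z 0 j * H A (delta_mx 0 j) l.
Proof.
rewrite /H /Defs.sesqui -mulmxA [LHS]mxE; apply: eq_bigr => j _.
by rewrite -mulmxA -rowE [row _ _ _ _]mxE.
Qed.

Lemma H_linearPl (a : C) z w l : H A (a *: z + w) l = a * H A z l + H A w l.
Proof. by rewrite /H /Defs.sesqui !mulmxDl -!scalemxAl !mxE. Qed.

Variable theta : 'rV[C]_g -> C^o.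
Hypothesis theta_norm : normalized_theta A theta.

(* Logarithmic derivative of the functional equation of theta. *)
Lemma h_period j z l : lattice A l -> theta z != 0 -> theta (z + l) != 0 ->
  h theta j (z + l) = h theta j z + pi%:C * H A (delta_mx 0 j) l.
Proof.
have [te [chi [chi1 _] thetaE] _ _] := theta_norm.
move=> ll z0 zl0; pose e := delta_mx 0 j : V g.
have sum_e (a : 'I_g -> C) : \sum_k a k * e 0 k = a j.
  rewrite (bigD1 j)//= big1 => [|k kj]; first by rewrite mxE !eqxx mulr1 addr0.
  by rewrite mxE (negbTE kj) andbF mulr0.
(* The left-hand side is the logarithmic derivative of theta (y + l) at [z] along e_j, so it
   suffices to compute that derivative again from the functional equation. *)
have := is_dlog_theta_shift te e zl0; rewrite sum_e => /is_dlog_unique; apply.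
rewrite [X in is_dlog _ _ X _](_ : _ = fun y =>
    chi l * cexp (pi%:C * H A y l + pi%:C / 2 * H A l l) * theta y); last first.
  by apply/funext => y; rewrite thetaE.
(* The constant [chi l], nonzero since of modulus 1, contributes 0; the exponential contributes pi
   H(e_j, l) and theta contributes h_j(z). *)
rewrite addrC -[pi%:C * H A _ _]add0r; apply: is_dlogM; last first.
  by have := is_dlog_theta te e z0; rewrite sum_e.
apply: is_dlogM.
  by apply: is_dlog_cst; rewrite -normr_eq0 chi1// oner_eq0.
apply: is_dlog_cexp => k; rewrite H_linearPl; ring.
Qed.

Lemma lambda_lattice i : lattice A (lambda A i).
Proof.
exists (delta_mx 0 i); rewrite (bigD1 i)//= big1 => [|k ki].
  by rewrite mxE !eqxx scale1r addr0.
by rewrite mxE (negbTE ki) andbF scale0r.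
Qed.

Lemma eta_period i j (c : R -> 'rV[C]_g) : path_by theta (lambda A i) c ->
  path_integral (Defs.eta theta j) c = pi%:C * H A (delta_mx 0 j) (lambda A i).
Proof.
move=> cp; have [te _ _ _] := theta_norm.
rewrite (path_integral_eta te j cp).
have [C1 c0 c1] := cp.
have t0 := c0 0; have t1 := c0 1.
rewrite lexx ler01 in t0; rewrite lexx ler01 in t1.
rewrite c1 h_period ?addrK ?t0//; first by rewrite addrC addKr.
- exact: lambda_lattice.
- by rewrite -c1 t1.
Qed.

(** The lattice [L] and the parameters [q] are left free so that the same formula serves G and G^*,
    whose loops both lie above the lambda_i. *)
Lemma path_integral_xi_G_loop (L : set 'rV[C]_g) s (q : 'I_s -> 'rV[C]_g)
    (alpha : 'I_(g + g) -> R -> 'rV[C]_g)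
    (gamma : 'I_(g + g) -> R -> 'rV[C]_(g + s)) i k :
  (forall k, theta (q k) != 0) ->
  (forall i, path_by theta (lambda A i) (alpha i)) ->
  normalized_loops theta A L q alpha gamma ->
  path_integral (xi_G theta q k) (gamma i) =
  \sum_j (q k 0 j * path_integral (Defs.eta theta j) (alpha i)
          - h theta j (q k) * path_integral (omega j) (alpha i)).
Proof.
move=> q0 alphaP [loops xt0 xiP]; have [te _ _ _] := theta_norm.
have [C1 gr _ _] := loops i.
rewrite path_integral_xi_G// xt0 xiP oppr0 add0r H_sum_delta mulr_sumr -sumrB.
by apply: eq_bigr => j _; rewrite (eta_period j (alphaP i)); ring.
Qed.

End QuasiPeriods.

(** * Explicit entries of the generalized logarithm matrices *)

Section GeneralizedLogarithms.
Context {R : realType}.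
Local Notation C := R[i].
Variables (g n : nat) (theta : 'rV[C]_g -> C^o) (L : set 'rV[C]_g).
Variables (p : 'I_n -> 'rV[C]_g) (a : 'I_n -> R -> 'rV[C]_g).
Variable (f : 'I_n -> 'I_g -> 'rV[C]_g -> C^o).
Hypothesis a_log : generalized_log theta L p a f.

Let omega_log i j : path_integral (omega j) (a i) = p i 0 j.
Proof.
have [ap _ _] := a_log; have [C1 _ a1] := ap i.
by rewrite path_integral_omega// a1 addrAC subrr add0r.
Qed.

Lemma log_AE : log_A theta a f =
  row_mx (\matrix_(i, j) p i 0 j) (\matrix_(i, j) h theta j (p i)).
Proof.
have [_ _ ah] := a_log.
by congr row_mx; apply/matrixP => i j; rewrite !mxE ?omega_log ?ah.
Qed.

Lemma log_AdualE : log_Adual theta a f =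
  row_mx (\matrix_(i, j) h theta j (p i)) (\matrix_(i, j) - p i 0 j).
Proof.
have [_ _ ah] := a_log.
by congr row_mx; apply/matrixP => i j; rewrite !mxE ?omega_log ?ah.
Qed.

End GeneralizedLogarithms.

(** * The three identities, compared entry by entry *)

Theorem lemma5p6 (R : realType) (g n s : nat)
  (* the abelian variety A and its normalized theta function *)
  (A : @ppav R g) (theta : 'rV[R[i]]_g -> R[i]^o)
  (theta_norm : normalized_theta A theta)
  (* logarithms p_i of the P_i and q_k of the Q_k *)
  (p : 'I_n -> 'rV[R[i]]_g) (q : 'I_s -> 'rV[R[i]]_g)
  (theta_p : forall i, theta (p i) != 0)
  (theta_q : forall k, theta (q k) != 0)
  (theta_pq : forall i k, theta (p i + q k) != 0)
  (* M = [u : X -> G] and its Cartier dual *)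
  (M : one_motive theta (lattice A) q n)
  (Mdual : one_motive theta (lattice_dual A) p s)
  (M_dual : cartier_dual M Mdual)
  (* R_i = (P_i, e^(l_i1), ..., e^(l_is)) *)
  (l : 'I_n -> 'I_s -> R[i])
  (l_coord : forall i k,
     cexp (l i k) = G_coord theta q k (u M (basis_vec i)))
  (* paths in A and loops in G and G^* *)
  (alpha : 'I_(g + g) -> R -> 'rV[R[i]]_g)
  (alpha_path : forall i, path_by theta (lambda A i) (alpha i))
  (gamma : 'I_(g + g) -> R -> 'rV[R[i]]_(g + s))
  (gamma_norm : normalized_loops theta A (lattice A) q alpha gamma)
  (gamma' : 'I_(g + g) -> R -> 'rV[R[i]]_(g + n))
  (gamma'_norm : normalized_loops theta A (lattice_dual A) p alpha gamma')
  (* generalized logarithms on A and A^* *)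
  (a : 'I_n -> R -> 'rV[R[i]]_g)
  (f : 'I_n -> 'I_g -> 'rV[R[i]]_g -> R[i]^o)
  (a_log : generalized_log theta (lattice A) p a f)
  (b : 'I_s -> R -> 'rV[R[i]]_g)
  (f' : 'I_s -> 'I_g -> 'rV[R[i]]_g -> R[i]^o)
  (b_log : generalized_log theta (lattice_dual A) q b f')
  (* compatible logarithms of F_(q_k)(p_i) and F_(p_i)(q_k) *)
  (logFq : 'I_n -> 'I_s -> R[i]) (logFp : 'I_s -> 'I_n -> R[i])
  (logFq_exp : forall i k, cexp (logFq i k) = F theta (q k) (p i))
  (logFp_exp : forall i k, cexp (logFp k i) = F theta (p i) (q k))
  (logF_compat : forall i k,
     logFq i k - logFp k i =
     \sum_j (h theta j (p i) * q k 0 j - h theta j (q k) * p i 0 j))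
  (* generalized logarithms on G and G^* *)
  (r : 'I_n -> R -> 'rV[R[i]]_(g + s))
  (phi : 'I_n -> 'I_s -> 'rV[R[i]]_(g + s) -> R[i]^o)
  (r_log : generalized_log_G theta (lattice A) p q
             (fun i => u M (basis_vec i)) l logFq r phi)
  (r' : 'I_s -> R -> 'rV[R[i]]_(g + n))
  (phi' : 'I_s -> 'I_n -> 'rV[R[i]]_(g + n) -> R[i]^o)
  (r'_log : generalized_log_G theta (lattice_dual A) q p
              (fun k => u Mdual (basis_vec k)) (fun k i => l i k) logFp r' phi') :
  [/\ Upsilon_Q theta q gamma = - (Pi_A theta alpha *m (log_Adual theta b f')^T),
      Upsilon_P theta p gamma' = - (Pi_Adual theta alpha *m (log_A theta a f)^T)
    & (Xi_R theta q r phi)^T + Xi_Rdual theta p r' phi' =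
      - (log_Adual theta b f' *m (log_A theta a f)^T)].
Proof.
have xiQ i k := path_integral_xi_G_loop theta_norm i k theta_q alpha_path gamma_norm.
have xiP i k := path_integral_xi_G_loop theta_norm i k theta_p alpha_path gamma'_norm.
rewrite (log_AE a_log) (log_AdualE b_log) !tr_row_mx; split.
(* The upper and lower halves of the rows correspond to lambda_i and lambda_(g+i); in each, the
   minus sign before q_k in the dual logarithm turns minus the product into the eta-periods times
   q_k minus the omega-periods times h(q_k). *)
- rewrite /Pi_A mul_block_col; apply/matrixP => i k.
  rewrite 2!mxE xiQ; case: (split_ordP i) => i' ->; rewrite ?col_mxEu ?col_mxEd;
    rewrite mxE [X in X + _]mxE [X in _ + X]mxE -big_split -sumrN /=;
    by apply: eq_bigr => j _; rewrite !mxE; ring.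
(* The exchange of the two halves and the sign in [Upsilon_P] match the block rows (N2, -Omega2) and
   (-N1, Omega1) of [Pi_Adual]. *)
- rewrite /Pi_Adual mul_block_col /Upsilon_P opp_col_mx.
  congr col_mx; apply/matrixP => i k; rewrite [LHS]mxE xiP [RHS]mxE [X in _ = - X]mxE
    [X in _ = - (X + _)]mxE [X in _ = - (_ + X)]mxE -big_split -!sumrN /=;
    by apply: eq_bigr => j _; rewrite !mxE; ring.
- rewrite mul_row_col; apply/matrixP => k i.
  have [_ _ _ rE] := r_log; have [_ _ _ r'E] := r'_log.
  rewrite [LHS]mxE 2![X in X + _ = _]mxE [X in _ + X = _]mxE rE r'E [RHS]mxE [X in _ = - X]mxE
    [X in _ = - (X + _)]mxE [X in _ = - (_ + X)]mxE -big_split -sumrN /=.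
  (* The left-hand side is (logFq - l) - (logFp - l), with the same l_(i,k) on G and on G^*. *)
  rewrite [LHS](_ : _ = logFq i k - logFp k i); last by rewrite /=; ring.
  rewrite logF_compat; apply: eq_bigr => j _; rewrite !mxE; ring.
Qed.
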